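(* Let $0<p<1/2$ and let $\Phi:\mathbb{N}\to[1,\infty)$ be any non-decreasing function satisfying $\lim_{n\to\infty}\Phi(n)=+\infty$. Then there exists a martingale $f\in H_p(G_2)$ such that $$\sum_{n=2}^{\infty}\frac{\log^pn\,\|R_n^wf\|_p^p\,\Phi(n)}{n^{2-2p}}=\infty ,$$ where $R_n^wf$ is the $n$-th Riesz logarithmic mean of the Walsh–Fourier series of $f$.
   Context: $G_2=\prod_{k\ge0}Z_2$ is the Walsh (dyadic) group with product topology and normalized Haar measure $\mu$. $I_0(x)=G_2$, $I_n(x)=\{y\in G_2: y_0=x_0,\ldots,y_{n-1}=x_{n-1}\}$. For $n=\sum_jn_j2^j$, $n_j\in\{0,1\}$, the Walsh functions are $w_n(x)=\prod_k\big((-1)^{x_k}\big)^{n_k}$. $\mathbb{N}=\{0,1,2,\ldots\}$. For $f\in L_1(G_2)$: $\widehat f^{\,w}(n)=\int_{G_2}f\,w_n\,d\mu$; $S_0^wf=0$, $S_n^wf=\sum_{k=0}^{n-1}\widehat f^{\,w}(k)w_k$. $\|g\|_p=(\int_{G_2}|g|^pd\mu)^{1/p}$. Let $\mathcal F_n$ be the $\sigma$-algebra generated by the sets $I_n(x)$, $x\in G_2$. A martingale is a sequence $f=(f^{(n)}:n\in\mathbb{N})$ of integrable functions with $f^{(n)}$ $\mathcal F_n$-measurable and $S^w_{2^n}f^{(l)}=f^{(n)}$ for $n\le l$. $H_p(G_2)$ is the space of martingales with $\|f\|_{H_p}:=\|\sup_n|f^{(n)}|\|_p<\infty$. For a martingale,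 $\widehat f^{\,w}(i)=\lim_{k\to\infty}\int_{G_2}f^{(k)}w_i\,d\mu$ and $S^w_nf=\sum_{k=0}^{n-1}\widehat f^{\,w}(k)w_k$. Riesz logarithmic means: for $n\ge2$, $R^w_nf=\frac1{l_n}\sum_{k=1}^{n-1}\frac{S^w_kf}{k}$ with $l_n=\sum_{k=1}^{n-1}\frac1k$. *)

(* Defs.v *)
From HB Require Import structures.
From mathcomp Require Import all_boot all_order all_algebra.
From mathcomp Require Import all_classical all_reals all_analysis.

Set Implicit Arguments.
Unset Strict Implicit.
Unset Printing Implicit Defensive.

Import Order.TTheory GRing.Theory Num.Theory.
Import numFieldNormedType.Exports.

Local Open Scope classical_set_scope.
Local Open Scope ring_scope.

(* The Walsh group: sequences of bits with the product topology, carrying its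
   Borel sigma-algebra. *)
Definition G2 : Type := g_sigma_algebraType (@open cantor_space).

HB.instance Definition _ := Measurable.on G2.

Definition G2add (x y : G2) : G2 := fun k : nat => x k (+) y k.

Definition translation_invariant (R : realType) (mu : probability G2 R) : Prop :=
  forall (a : G2) (A : set G2), measurable A -> mu (G2add a @` A) = mu A.

Definition dyadic_interval (n : nat) (x : G2) : set G2 :=
  [set y : G2 | forall k : nat, (k < n)%N -> y k = x k].

(* G2 with the sub-sigma-algebra generated by the dyadic intervals of rank n. *)
Definition G2_filtration (n : nat) : Type :=
  g_sigma_algebraType (range (dyadic_interval n)).

HB.instance Definition _ (n : nat) := Measurable.on (G2_filtration n).

Definition binary_digit (n k : nat) : bool := odd (n %/ 2 ^ k).

(* The product over all k is finite: since n < 2 ^ n, the digits of n of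
   index at least n vanish. *)
Definition walsh (R : realType) (n : nat) (x : G2) : R :=
  \prod_(k < n) ((-1) ^+ (x k : nat)) ^+ (binary_digit n k : nat).

Section WalshFourier.
Context (R : realType) (mu : probability G2 R).

Definition walsh_coef (g : G2 -> R) (i : nat) : R :=
  \int[mu]_(x in [set: G2]) (g x * walsh R i x).

Definition walsh_psum (g : G2 -> R) (n : nat) (x : G2) : R :=
  \sum_(k < n) walsh_coef g k * walsh R k x.

(* The equality in mart_psum is pointwise: an almost everywhere equality between
   functions measurable for the n-th sigma-algebra holds everywhere, as the
   atoms of this sigma-algebra have measure 2 ^- n. *)
Record martingale (f : nat -> G2 -> R) : Prop := Martingale {
  mart_integrable : forall n, mu.-integrable [set: G2] (EFin \o f n) ;
  mart_adapted : forall n,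
    measurable_fun [set: G2_filtration n] (f n : G2_filtration n -> R) ;
  mart_psum : forall n l, (n <= l)%N -> walsh_psum (f l) (2 ^ n) = f n }.

Definition mart_maximal (f : nat -> G2 -> R) (x : G2) : \bar R :=
  ereal_sup [set `|f n x|%:E | n in [set: nat]].

Definition Hp_norm (p : R) (f : nat -> G2 -> R) : \bar R :=
  'N[mu]_(p%:E)[mart_maximal f]%E.

Definition mart_coef (f : nat -> G2 -> R) (i : nat) : R :=
  lim ((fun k : nat => walsh_coef (f k) i) @ \oo).

Definition mart_walsh_psum (f : nat -> G2 -> R) (n : nat) (x : G2) : R :=
  \sum_(k < n) mart_coef f k * walsh R k x.

Definition riesz_weight (n : nat) : R := \sum_(1 <= k < n) k%:R^-1.

(* Only meaningful for n >= 2. *)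
Definition riesz_mean (f : nat -> G2 -> R) (n : nat) (x : G2) : R :=
  (riesz_weight n)^-1 * \sum_(1 <= k < n) mart_walsh_psum f k x / k%:R.

End WalshFourier.

(* Main.v *)
Require Import Defs.
From HB Require Import structures.
From mathcomp Require Import all_boot all_order all_algebra.
From mathcomp Require Import all_classical all_reals all_analysis.
From mathcomp Require Import measurable_realfun ring lra zify.

Set Implicit Arguments.
Unset Strict Implicit.
Unset Printing Implicit Defensive.

Import Order.TTheory GRing.Theory Num.Theory.
Import numFieldNormedType.Exports.

Local Open Scope classical_set_scope.
Local Open Scope ring_scope.

(** For a nonnegative sequence [c] with [c 0 = 0], let [f] be the martingale whose
    Walsh coefficients are [c m] on the frequency block [2^m <= i < 2^(m+1)].
    The sum of [w_i] over this block is [2^m] in absolute value on [I_m(0)] and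
    vanishes elsewhere, so that [||f||_{H_p}^p <= \sum_m a_m] with
    [a_m = (c m 2^m)^p / 2^m].

    For the divergence no estimate of a kernel is needed: since
    [l_(n+1) R_(n+1) f - l_n R_n f = S_n f / n], one has
    [||l_n R_n f||_p^p + ||l_(n+1) R_(n+1) f||_p^p >= ||S_n f / n||_p^p],
    and for [n] odd in block [m] the function [|S_n f|] equals [c m] on the half
    [x_0 = 1] of the group. Hence block [m] contributes at least a constant
    times [a_m Phi(2^m)] to the series. Finally
    [a_m = 1 / Phi(2^(m-1)) - 1 / Phi(2^m)] is summable, while
    [a_m Phi(2^m) >= ln Phi(2^m) - ln Phi(2^(m-1))] is not. *)

(** * Topology and measurability on the Walsh group *)

Lemma open_coord (k : nat) (b : bool) :
  open ([set x | x k = b] : set cantor_space).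
Proof.
apply: (open_comp (f := fun x : cantor_space => x k) (D := [set b])).
  by move=> + _; exact: (@proj_continuous _ (fun=> bool) k).
exact: discrete_open.
Qed.

Lemma measurable_coord (k : nat) (b : bool) :
  measurable ([set x | x k = b] : set G2).
Proof. by apply: sub_sigma_algebra; exact: open_coord. Qed.

Lemma measurable_dyadic_interval (n : nat) (x : G2) :
  measurable (dyadic_interval n x).
Proof.
have -> : dyadic_interval n x =
    \bigcap_(k in [set k | (k < n)%N]) [set y : G2 | y k = x k].
  by apply/seteqP; split => y /= xy k /xy.
by apply: bigcap_measurableType => k _; exact: measurable_coord.
Qed.

Lemma G2addK (a : G2) : involutive (G2add a).
Proof. by move=> x; apply/funext => k; rewrite /G2add addbA addbb. Qed.

Lemma G2add_continuous (a : G2) :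
  continuous (G2add a : cantor_space -> cantor_space).
Proof.
move=> x; apply/cvg_sup => k A [B [[V oV <-] Vx] VA].
have xk : nbhs (x : cantor_space) [set y | y k = x k].
  by apply: open_nbhs_nbhs; split => //; exact: open_coord.
(* Coordinate [k] of the translate depends on coordinate [k] of the point alone, which is constant
   on the neighbourhood [xk]. *)
apply: filterS xk => y /= yxk; apply: VA => /=.
by rewrite /G2add yxk.
Qed.

Lemma measurable_G2add (a : G2) : measurable_fun [set: G2] (G2add a).
Proof.
apply: (@measurability _ _ G2 G2 _ _ (@open cantor_space)) => // _ [B oB <-].
rewrite setTI; apply: sub_sigma_algebra.
by apply: open_comp oB => x _; exact: G2add_continuous.
Qed.

(** * Consequences of translation invariance *)

Section Haar.
Context (R : realType) (mu : probability G2 R).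
Hypothesis mu_haar : translation_invariant mu.

Lemma haar_preimage (a : G2) (A : set G2) :
  measurable A -> mu (G2add a @^-1` A) = mu A.
Proof.
move=> mA; rewrite -(mu_haar a mA); congr (mu _); apply/seteqP; split => x /=.
  by move=> Ax; exists (G2add a x) => //; rewrite G2addK.
by move=> [y Ay <-]; rewrite G2addK.
Qed.

(** Change of variables: the pushforward of [mu] under a translation is [mu] itself. *)
Lemma Rintegral_G2add (a : G2) (g : G2 -> R) :
  mu.-integrable [set: G2] (EFin \o (g \o G2add a)) ->
  measurable_fun [set: G2] g ->
  \int[mu]_x g (G2add a x) = \int[mu]_x g x.
Proof.
move=> ig mg; rewrite /Rintegral; congr fine.
transitivity (\int[pushforward mu (G2add a)]_x (g x)%:E)%E.
  rewrite (integral_pushforward (measurable_G2add a)) //.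
  exact/measurable_EFinP.
apply: eq_measure_integral => [|mG A mA _]; first exact: measurable_G2add.
by rewrite -[RHS](haar_preimage a).
Qed.

(** Bit [n] splits an interval of rank [n] into two halves exchanged by translation by the [n]-th
    unit vector, so each half has half the measure. *)
Lemma haar_dyadic_interval (n : nat) (x : G2) :
  mu (dyadic_interval n x) = (2 ^- n)%:E.
Proof.
elim: n => [|n IHn].
  rewrite expr0 invr1 -(@probability_setT _ _ _ mu); congr (mu _).
  by apply/seteqP; split.
pose e : G2 := fun k => k == n.
have Isplit : dyadic_interval n x =
    dyadic_interval n.+1 x `|` G2add e @^-1` dyadic_interval n.+1 x.
  apply/seteqP; split => y /=.
    move=> yx; have [yxn|yxn] := eqVneq (y n) (x n); [left|right] => k.
      by rewrite ltnS leq_eqVlt => /predU1P[->//|]; exact: yx.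
    rewrite ltnS /G2add /e leq_eqVlt => /predU1P[->|kn].
      by rewrite eqxx; move: yxn; case: (y n) (x n) => [] [].
    by rewrite ltn_eqF // yx.
  move=> [] yx k kn; first by apply: yx; rewrite ltnS ltnW.
  by have := yx k; rewrite /G2add /e ltn_eqF //= => ->; rewrite // ltnS ltnW.
have mI := measurable_dyadic_interval n.+1 x.
have mI' : measurable (G2add e @^-1` dyadic_interval n.+1 x).
  by rewrite -[X in measurable X]setTI; exact: measurable_G2add.
have disj : dyadic_interval n.+1 x `&`
    G2add e @^-1` dyadic_interval n.+1 x = set0.
  apply/seteqP; split => // y /= [yx] /(_ n (ltnSn n)).
  by rewrite /G2add /e eqxx yx //; case: (x n).
have : (mu (dyadic_interval n x) =
    mu (dyadic_interval n.+1 x) + mu (dyadic_interval n.+1 x))%E.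
  by rewrite [in LHS]Isplit measureU //; congr (_ + _)%E; exact: haar_preimage.
rewrite IHn; have := fin_num_measure mu _ mI.
case: (mu (dyadic_interval n.+1 x)) => // r _; rewrite -EFinD => -[rE].
congr EFin; apply: (@mulIf _ 2); first by rewrite pnatr_eq0.
by rewrite exprSr invfM mulfVK ?pnatr_eq0 // rE; ring.
Qed.

End Haar.

(** * Binary digits *)

Lemma binary_digit_small (n k : nat) : (n < 2 ^ k)%N -> binary_digit n k = false.
Proof. by move=> nk; rewrite /binary_digit divn_small. Qed.

Lemma binary_digitS (n k : nat) : binary_digit n k.+1 = binary_digit n./2 k.
Proof. by rewrite /binary_digit expnS divnMA divn2. Qed.

Lemma binary_digit_add_exp (m i k : nat) : (i < 2 ^ m)%N -> (k <= m)%N ->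
  binary_digit (2 ^ m + i) k = if k == m then true else binary_digit i k.
Proof.
rewrite /binary_digit => im km; rewrite divnDl ?dvdn_exp2l // oddD.
have [->|nkm] := eqVneq k m.
  by rewrite divnn expn_gt0 divn_small.
have : (0 < m - k)%N by rewrite subn_gt0 ltn_neqAle nkm.
by rewrite -expnB // oddX; case: (m - k)%N.
Qed.

(** Strong induction by halving: digit 0 is the parity, and the remaining digits are those of the
    half. *)
Lemma binary_digit_inj (m n : nat) : binary_digit m =1 binary_digit n -> m = n.
Proof.
elim/ltn_ind: m n => m IHm n mn.
have half_eq : (m./2 <= m)%N by rewrite -divn2 leq_div.
have odd_eq : odd m = odd n by have := mn 0%N; rewrite /binary_digit !divn1.
have [m0|m_gt0] := posnP m.
  have {}mn : binary_digit n =1 xpred0.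
    by move=> k; rewrite -mn m0 binary_digit_small // expn_gt0.
  have [//|n_gt0] := posnP n; first by rewrite m0.
  (* A positive [n] has leading digit 1 at position [trunc_log 2 n], contradicting that all its
     digits vanish. *)
  have := mn (trunc_log 2 n).
  have /andP[lo hi] := trunc_log_bounds (ltnSn 1) n_gt0.
  move: (mn (trunc_log 2 n)); rewrite -[X in binary_digit X _](subnKC lo).
  by rewrite binary_digit_add_exp ?eqxx // ltn_subLR // addnn -mul2n -expnS.
rewrite -(odd_double_half m) -(odd_double_half n) odd_eq; congr (_ + _.*2)%N.
apply: IHm => [|k]; first by lia.
by rewrite -!binary_digitS.
Qed.

(** * Walsh functions and the Dirichlet kernels of order a power of two *)

Section WalshFunctions.
Context (R : realType).
Implicit Types (i j k m n N : nat) (x : G2).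

(** The digits of [i] vanish from index [i] on and from index [N] on, so the products up to [i] and
    up to [N] both agree with the one up to [i + N]. *)
Lemma walshE N i x : (i < 2 ^ N)%N ->
  walsh R i x = \prod_(k < N) ((-1) ^+ (x k : nat)) ^+ (binary_digit i k : nat).
Proof.
pose W n : R := \prod_(k < n) ((-1) ^+ (x k : nat)) ^+ (binary_digit i k : nat).
have WD n d : (i < 2 ^ n)%N -> W (n + d)%N = W n.
  move=> i_n; elim: d => [|d IHd]; first by rewrite addn0.
  rewrite addnS /W big_ord_recr /= binary_digit_small ?expr0 ?mulr1 //.
  by rewrite (leq_trans i_n) // leq_pexp2l // leq_addr.
move=> iN; transitivity (W (i + N)%N); last by rewrite addnC; exact: WD.
by rewrite WD; last exact: ltn_expl.
Qed.

Lemma walsh_add_exp m i x : (i < 2 ^ m)%N ->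
  walsh R (2 ^ m + i) x = (-1) ^+ (x m : nat) * walsh R i x.
Proof.
move=> im; have lt2 : (2 ^ m + i < 2 ^ m.+1)%N.
  by rewrite expnS mul2n -addnn ltn_add2l.
rewrite (walshE x lt2) (walshE x im) big_ord_recr /= binary_digit_add_exp //.
rewrite eqxx expr1 mulrC; congr (_ * _); apply: eq_bigr => k _.
by rewrite binary_digit_add_exp // ?ltn_eqF // ltnW.
Qed.

Lemma walsh_doubleS i x :
  walsh R i.*2.+1 x = (-1) ^+ (x 0%N : nat) * walsh R i.*2 x.
Proof.
have i2 : (i.*2.+1 < 2 ^ i.+1)%N.
  by have := ltn_expl i (ltnSn 1); rewrite expnS; lia.
rewrite (walshE x i2) (walshE x (ltnW i2)) !big_ord_recl /=.
rewrite {1 3}/binary_digit !divn1 /= odd_double expr0 mul1r expr1; congr (_ * _).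
by apply: eq_bigr => k _; rewrite !binary_digitS /= uphalf_double doubleK.
Qed.

Lemma walsh_flip i k x : walsh R i (G2add (fun j => j == k) x) =
  (-1) ^+ (binary_digit i k : nat) * walsh R i x.
Proof.
have i2 : (i < 2 ^ (i + k.+1))%N.
  by rewrite (leq_trans (ltn_expl i (ltnSn 1))) // leq_pexp2l // leq_addr.
have kN : (k < i + k.+1)%N by lia.
have split_k y : walsh R i y = ((-1) ^+ (y k : nat)) ^+ (binary_digit i k : nat) *
    \prod_(j < i + k.+1 | j != Ordinal kN)
      ((-1) ^+ (y j : nat)) ^+ (binary_digit i j : nat).
  by rewrite (walshE _ i2) (bigD1 (Ordinal kN)).
rewrite !split_k mulrA; congr (_ * _).
  by rewrite /G2add eqxx addTb -exprMn; case: (x k); case: binary_digit;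
    rewrite ?expr0 ?expr1 ?mul1r ?mulr1 // mulrNN mulr1.
apply: eq_bigr => j /negbTE jk; rewrite /G2add.
by rewrite -(inj_eq val_inj) /= in jk; rewrite jk.
Qed.

Lemma normr_walsh i x : `|walsh R i x| = 1.
Proof.
by rewrite /walsh normr_prod big1 // => k _; rewrite !normrX normrN1 !expr1n.
Qed.

Lemma walsh0 x : walsh R 0 x = 1.
Proof. by rewrite /walsh big_ord0. Qed.

(** The second half of the sum is the first half times the sign of bit [m]: the two halves add up if
    this bit is 0 and cancel if it is 1. *)
Lemma dirichlet_exp m x :
  \sum_(0 <= i < 2 ^ m) walsh R i x =
  2 ^+ m * \1_(dyadic_interval m (fun=> false)) x.
Proof.
elim: m => [|m IHm].
  rewrite expn0 big_nat1 walsh0 expr0 mul1r indicE mem_set //.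
have e2 : (2 ^ m.+1 = 2 ^ m + 2 ^ m)%N by rewrite expnS mul2n addnn.
rewrite e2 (big_cat_nat (n := 2 ^ m)) ?leq_addr //= -{2}(add0n (2 ^ m)%N).
rewrite big_addn addnK [X in _ + X](eq_big_nat _ _
  (F2 := fun i => (-1) ^+ (x m : nat) * walsh R i x)); last first.
  by move=> i /andP[_ im]; rewrite addnC walsh_add_exp.
rewrite -mulr_sumr IHm !indicE.
case xm : (x m) => /=.
  rewrite expr1 mulN1r subrr memNset ?mulr0 // => /(_ m (ltnSn m)).
  by rewrite xm.
have -> : (x \in dyadic_interval m.+1 (fun=> false)) =
          (x \in dyadic_interval m (fun=> false)).
  apply/idP/idP; rewrite !inE => xI k km; first by apply: xI; rewrite ltnS ltnW.
  by move: km; rewrite ltnS leq_eqVlt => /predU1P[->//|]; exact: xI.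
by rewrite expr0 mul1r exprS; ring.
Qed.

Lemma walsh_block_sum m x :
  \sum_(2 ^ m <= i < 2 ^ m.+1) walsh R i x =
  (-1) ^+ (x m : nat) * (2 ^+ m * \1_(dyadic_interval m (fun=> false)) x).
Proof.
have e2 : (2 ^ m.+1 = 2 ^ m + 2 ^ m)%N by rewrite expnS mul2n addnn.
rewrite e2 -{1}(add0n (2 ^ m)%N) big_addn addnK -dirichlet_exp mulr_sumr.
by apply: eq_big_nat => i /andP[_ im]; rewrite addnC walsh_add_exp.
Qed.

(** The map [g] lets one statement serve the Borel sigma-algebra and every sigma-algebra of the
    filtration; only the first [N] bits have to be measurable. *)
Lemma measurable_walsh d (T : measurableType d) (g : T -> G2) N i :
  (i < 2 ^ N)%N -> (forall k, (k < N)%N -> measurable [set t | g t k]) ->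
  measurable_fun [set: T] (fun t => walsh R i (g t)).
Proof.
move=> iN mg.
have -> : (fun t => walsh R i (g t)) = (fun t => \prod_(k < N)
    ((-1) ^+ (g t k : nat)) ^+ (binary_digit i k : nat)).
  by apply/funext => t; exact: walshE.
apply: measurable_prod => k _.
have mk : measurable_fun [set: T] (fun t => g t k).
  apply: (measurable_fun_bool true); rewrite setTI.
  exact: mg.
exact: (@measurableT_comp _ _ _ _ _ _
  (fun b : bool => ((-1 : R) ^+ (b : nat)) ^+ (binary_digit i k : nat))).
Qed.

Lemma measurable_walsh_G2 i : measurable_fun [set: G2] (walsh R i).
Proof.
apply: (measurable_walsh (g := id) (N := i)); first exact: ltn_expl.
by move=> k _; exact: (measurable_coord k true).
Qed.

Lemma measurable_walsh_filtration n i : (i < 2 ^ n)%N ->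
  measurable_fun [set: G2_filtration n] (walsh R i : G2_filtration n -> R).
Proof.
move=> i_n; apply: (measurable_walsh (g := id : G2_filtration n -> G2) i_n).
move=> k kn; pose e (t : n.-tuple bool) : G2 := fun j => nth false t j.
(* For [k < n] this set is a finite union of intervals of rank [n], indexed by the possible first
   [n] bits. *)
have -> : [set x : G2_filtration n | x k] =
    \bigcup_(t in [set t : n.-tuple bool | nth false t k]) dyadic_interval n (e t).
  apply/seteqP; split => [x /= xk|x [t /= tk xt]].
    exists [tuple of mkseq x n]; first by rewrite /= nth_mkseq.
    by move=> j jn; rewrite /e nth_mkseq.
  by rewrite /= xt.
apply: fin_bigcup_measurable => [|t _]; first exact: finite_finset.
by apply: sub_sigma_algebra; exists (e t).
Qed.

End WalshFunctions.

(** * Orthonormality, and martingales with prescribed Walsh coefficients *)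

Section WalshPolynomials.
Context (R : realType) (mu : probability G2 R).
Implicit Types (c d : nat -> R) (i j k m n N : nat) (x : G2).

Lemma bounded_measurable_integrable (g : G2 -> R) (M : R) :
  measurable_fun [set: G2] g -> (forall x, `|g x| <= M) ->
  mu.-integrable [set: G2] (EFin \o g).
Proof.
move=> mg gM; apply: measurable_bounded_integrable => //.
  exact: le_lt_trans (probability_le1 mu measurableT) (ltry _).
exists M; split; first exact: num_real.
by move=> r Mr x _ /=; rewrite (le_trans (gM x)) // ltW.
Qed.

Definition walsh_poly d n x : R := \sum_(k < n) d k * walsh R k x.

Lemma walsh_polyS d n x :
  walsh_poly d n.+1 x = walsh_poly d n x + d n * walsh R n x.
Proof. by rewrite /walsh_poly big_ord_recr. Qed.

Lemma measurable_walsh_poly d n : measurable_fun [set: G2] (walsh_poly d n).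
Proof.
apply: measurable_sum => k; apply: measurable_funM => //.
exact: measurable_walsh_G2.
Qed.

Lemma normr_walsh_poly d n x : `|walsh_poly d n x| <= \sum_(k < n) `|d k|.
Proof.
rewrite (le_trans (ler_norm_sum _ _ _)) // ler_sum // => k _.
by rewrite normrM normr_walsh mulr1.
Qed.

Hypothesis mu_haar : translation_invariant mu.

(* Translating by a coordinate where the digits of i and j differ changes the
   sign of the integrand. *)
Lemma walsh_orthonormal i j :
  \int[mu]_x (walsh R i x * walsh R j x) = (i == j)%:R.
Proof.
have mw : measurable_fun [set: G2] (fun x => walsh R i x * walsh R j x).
  by apply: measurable_funM; exact: measurable_walsh_G2.
have [<-|/eqP ij] := eqVneq i j.
  rewrite (eq_Rintegral mu (g := fun=> 1)) => [|x _].
    by rewrite Rintegral_cst // mul1r [X in fine X](probability_setT mu).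
  by rewrite -expr2 -real_normK ?num_real // normr_walsh expr1n.
have [k dk] : exists k, binary_digit i k != binary_digit j k.
  apply/not_existsP => ijk; apply: ij; apply: binary_digit_inj => k.
  by apply/eqP; apply: contrapT => /negP; exact: ijk.
pose e : G2 := fun l => l == k.
have flip x : walsh R i (G2add e x) * walsh R j (G2add e x) =
    - (walsh R i x * walsh R j x).
  rewrite /e !walsh_flip; move: dk.
  by case: (binary_digit i k); case: (binary_digit j k) => //= _; ring.
have iw : mu.-integrable [set: G2] (EFin \o (fun x => walsh R i x * walsh R j x)).
  apply: (@bounded_measurable_integrable _ 1) => // x.
  by rewrite normrM !normr_walsh mulr1.
have iwe : mu.-integrable [set: G2]
    (EFin \o ((fun x => walsh R i x * walsh R j x) \o G2add e)).
  apply: (@bounded_measurable_integrable _ 1) => [|x /=].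
    by apply: measurableT_comp => //; exact: measurable_G2add.
  by rewrite flip normrN normrM !normr_walsh mulr1.
have := Rintegral_G2add mu_haar iwe mw.
rewrite (eq_Rintegral mu (g := fun x => -1 * (walsh R i x * walsh R j x))); last first.
  by move=> x _; rewrite flip mulN1r.
have opp_fix (r : R) : -1 * r = r -> r = 0 by lra.
by rewrite RintegralZl // => /opp_fix.
Qed.

Lemma walsh_coef_poly d n i :
  walsh_coef mu (walsh_poly d n) i = if (i < n)%N then d i else 0.
Proof.
rewrite /walsh_coef; elim: n => [|n IHn].
  under eq_Rintegral do rewrite /walsh_poly big_ord0 mul0r.
  by rewrite Rintegral_cst // mul0r.
under eq_Rintegral do rewrite walsh_polyS mulrDl -mulrA.
have int_poly N d' : mu.-integrable [set: G2]
    (EFin \o (fun x => walsh_poly d' N x * walsh R i x)).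
  apply: (@bounded_measurable_integrable _ (\sum_(k < N) `|d' k|)).
    apply: measurable_funM; first exact: measurable_walsh_poly.
    exact: measurable_walsh_G2.
  by move=> x; rewrite normrM normr_walsh mulr1 normr_walsh_poly.
have int_walsh k a : mu.-integrable [set: G2]
    (EFin \o (fun x => a * (walsh R k x * walsh R i x))).
  apply: (@bounded_measurable_integrable _ `|a|).
    by apply: measurable_funM => //; apply: measurable_funM;
      exact: measurable_walsh_G2.
  by move=> x; rewrite !normrM !normr_walsh !mulr1.
rewrite RintegralD // IHn RintegralZl //; last first.
  by have := int_walsh n 1; under eq_fun do rewrite mul1r.
rewrite walsh_orthonormal ltnS [(i <= n)%N]leq_eqVlt eq_sym.
case: (eqVneq i n) => [->|_] /=; first by rewrite ltnn add0r mulr1.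
by rewrite mulr0 addr0.
Qed.

(** By orthonormality a partial sum merely truncates a Walsh polynomial, so every coefficient
    sequence is admissible. *)
Lemma walsh_poly_martingale d : martingale mu (fun n => walsh_poly d (2 ^ n)).
Proof.
split=> [n|n|n l nl].
- apply: (@bounded_measurable_integrable _ (\sum_(k < 2 ^ n) `|d k|)).
    exact: measurable_walsh_poly.
  by move=> x; exact: normr_walsh_poly.
- rewrite (_ : walsh_poly d (2 ^ n) = fun x => \sum_(k <- index_enum 'I_(2 ^ n))
    d k * walsh R k x) //.
  apply: measurable_sum => k; apply: measurable_funM => //.
  exact: measurable_walsh_filtration.
- apply/funext => x; apply: eq_bigr => k _; rewrite walsh_coef_poly.
  by rewrite (leq_trans (ltn_ord k)) // leq_pexp2l.
Qed.

Lemma mart_coef_walsh_poly d i :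
  mart_coef mu (fun n => walsh_poly d (2 ^ n)) i = d i.
Proof.
(* The sequence is constant from [n = i] on, since then [i < 2 ^ n]. *)
apply: lim_near_cst => //; exists i => // n /= ni.
by rewrite walsh_coef_poly (leq_ltn_trans ni) // ltn_expl.
Qed.

Lemma mart_walsh_psum_poly d n :
  mart_walsh_psum mu (fun n => walsh_poly d (2 ^ n)) n = walsh_poly d n.
Proof.
by apply/funext => x; apply: eq_bigr => k _; rewrite mart_coef_walsh_poly.
Qed.

End WalshPolynomials.

(** * Block coefficients and the Hardy norm *)

Section HpNorm.
Context (R : realType) (mu : probability G2 R).
Implicit Types (c : nat -> R) (i j k m n N : nat) (x : G2).

Lemma powR_subadditive (p a b : R) : 0 < p <= 1 -> 0 <= a -> 0 <= b ->
  (a + b) `^ p <= a `^ p + b `^ p.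
Proof.
move=> /andP[p0 p1] a0 b0; have [ab0|ab0] := eqVneq (a + b) 0.
  by rewrite ab0 powR0 ?gt_eqF // addr_ge0 // powR_ge0.
have {}ab0 : 0 < a + b by rewrite lt_neqAle eq_sym ab0 addr_ge0.
have le_pow t : 0 <= t <= 1 -> t <= t `^ p.
  move=> /andP[]; rewrite le_eqVlt => /predU1P[<- _|t0 t1]; first exact: powR_ge0.
  by rewrite ger1_powR // t0.
have frac t : 0 <= t -> t <= a + b -> t / (a + b) <= (t / (a + b)) `^ p.
  move=> t0 tab; apply: le_pow; rewrite divr_ge0 ?(ltW ab0) //=.
  by rewrite ler_pdivrMr // mul1r.
have [abp ab'] : 0 < (a + b) `^ p /\ 0 <= (a + b)^-1.
  by split; [exact: powR_gt0|rewrite invr_ge0 ltW].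
have := lerD (frac a a0 _) (frac b b0 _).
rewrite lerDl lerDr => /(_ b0 a0); rewrite -mulrDl divff ?gt_eqF //.
rewrite !powRM // -mulrDl => le1.
have -> : a `^ p + b `^ p =
    (a `^ p + b `^ p) * (a + b)^-1 `^ p * (a + b) `^ p.
  by rewrite -mulrA -powRM ?(ltW ab0) // mulVf ?gt_eqF // powR1 mulr1.
by rewrite ler_peMl // ltW.
Qed.

Lemma powR_sum_subadditive (p : R) (u : nat -> R) n :
  0 < p <= 1 -> (forall m, 0 <= u m) ->
  (\sum_(m < n) u m) `^ p <= \sum_(m < n) u m `^ p.
Proof.
move=> p01 u0; elim: n => [|n IHn].
  by rewrite !big_ord0 powR0 // gt_eqF //; case/andP: p01.
rewrite !big_ord_recr /= (le_trans (powR_subadditive p01 _ _)) ?lerD2r //.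
by rewrite sumr_ge0.
Qed.

(** Frequency 0 lies in no dyadic block, but [trunc_log 2 0] is 0 and would place it next to
    frequency 1; hence the separate case. *)
Definition block_coef c i : R := if i is 0 then 0 else c (trunc_log 2 i).

Lemma block_coef_exp c m i :
  (2 ^ m <= i < 2 ^ m.+1)%N -> block_coef c i = c m.
Proof.
move=> mi; have i0 : (0 < i)%N.
  by case/andP: mi => /(leq_trans _)->; rewrite ?expn_gt0.
by rewrite /block_coef -(prednK i0) prednK // (trunc_log_eq _ mi).
Qed.

Lemma walsh_poly_block c n x : walsh_poly (block_coef c) (2 ^ n) x =
  \sum_(m < n) c m * ((-1) ^+ (x m : nat) *
    (2 ^+ m * \1_(dyadic_interval m (fun=> false)) x)).
Proof.
elim: n => [|n IHn].
  by rewrite expn0 walsh_polyS /walsh_poly !big_ord0 mul0r add0r.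
rewrite big_ord_recr -IHn /= -walsh_block_sum /walsh_poly.
rewrite -(big_mkord xpredT (fun k => block_coef c k * walsh R k x)).
rewrite (big_cat_nat (n := 2 ^ n)) ?leq_pexp2l //= big_mkord mulr_sumr.
congr (_ + _); apply: eq_big_nat => k kn.
by rewrite (block_coef_exp _ kn).
Qed.

Lemma normr_walsh_poly_block_powR (p : R) c n x : 0 < p <= 1 ->
  (forall m, 0 <= c m) ->
  `|walsh_poly (block_coef c) (2 ^ n) x| `^ p <=
  \sum_(m < n) (c m * 2 ^+ m) `^ p * \1_(dyadic_interval m (fun=> false)) x.
Proof.
move=> p01 c0; have p_neq0 : p != 0 by case/andP: p01 => /gt_eqF ->.
pose u m : R := c m * 2 ^+ m * \1_(dyadic_interval m (fun=> false)) x.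
have u0 m : 0 <= u m by rewrite !mulr_ge0 // exprn_ge0.
apply: (@le_trans _ _ ((\sum_(m < n) u m) `^ p)).
  apply: ge0_ler_powR; rewrite ?nnegrE ?sumr_ge0 //; first by case/andP: p01 => /ltW.
  rewrite walsh_poly_block (le_trans (ler_norm_sum _ _ _)) // ler_sum // => m _.
  rewrite !normrM normrX normrN1 expr1n mul1r mulrA.
  by rewrite (ger0_norm (c0 _)) normrX ger0_norm // ger0_norm // indicE ler0n.
rewrite (le_trans (powR_sum_subadditive _ _ _)) // ler_sum // => m _.
rewrite /u powRM ?mulr_ge0 ?exprn_ge0 // indicE.
by case: (_ \in _); rewrite ?powR1 ?powR0.
Qed.

Lemma measurable_mart_maximal (f : nat -> G2 -> R) :
  (forall n, measurable_fun [set: G2] (f n)) ->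
  measurable_fun [set: G2] (mart_maximal f).
Proof.
move=> mf.
have -> : mart_maximal f = fun x => esups (fun n => `|f n x|%:E) 0%N.
  apply/funext => x; rewrite /mart_maximal /esups; congr ereal_sup.
  apply/seteqP; split => [_ [n _ <-]|_ [n _ <-]]; first by exists n.
  by exists n.
apply: (measurable_fun_esups (f := fun n x => `|f n x|%:E)) => n.
by apply/measurable_EFinP; exact: measurableT_comp.
Qed.

Hypothesis mu_haar : translation_invariant mu.

(** The series of the [h m] dominates the [p]-th power of every [|f n|], hence of the maximal
    function; it is integrated termwise, [I m] having measure [2 ^- m]. *)
Lemma Hp_norm_walsh_poly_block (p : R) c : 0 < p <= 1 -> (forall m, 0 <= c m) ->
  (Hp_norm mu p (fun n => walsh_poly (block_coef c) (2 ^ n)) `^ p <=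
   \sum_(0 <= m <oo) ((c m * 2 ^+ m) `^ p / 2 ^+ m)%:E)%E.
Proof.
move=> p01 c0; have p0 : 0 < p by case/andP: p01.
have p_neq0 : p != 0 by rewrite gt_eqF.
rewrite /Hp_norm poweR_Lnorm //.
set f := fun n => _; pose I m := dyadic_interval m (fun=> false).
have mI m : measurable (I m) := measurable_dyadic_interval m _.
pose h m x : \bar R := ((c m * 2 ^+ m) `^ p * \1_(I m) x)%:E.
have h0 m x : (0 <= h m x)%E by rewrite lee_fin mulr_ge0 // powR_ge0.
have mh m : measurable_fun [set: G2] (h m).
  by apply/measurable_EFinP; apply: measurable_funM => //; exact: measurable_indic.
have ->: (\sum_(0 <= m <oo) ((c m * 2 ^+ m) `^ p / 2 ^+ m)%:E =
          \int[mu]_x (\sum_(0 <= m <oo) h m x))%E.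
  rewrite integral_nneseries //; apply: eq_eseriesr => m _.
  under eq_integral do rewrite /h EFinM.
  rewrite ge0_integralZl //; last 2 first.
  - by apply/measurable_EFinP; exact: measurable_indic.
  - by rewrite lee_fin powR_ge0.
  by rewrite integral_indic // setIT [X in (_ * X)%E](haar_dyadic_interval mu_haar) -EFinM.
apply: ge0_le_integral => //.
- by move=> x _; exact: poweR_ge0.
- apply: (measurableT_comp (measurable_poweR p)).
  apply: measurableT_comp => //; apply: measurable_mart_maximal => n.
  exact: measurable_walsh_poly.
- exact: ge0_emeasurable_sum.
move=> x _; have G0 : (0 <= \sum_(0 <= m <oo) h m x)%E by exact: nneseries_ge0.
(* Taking the [p]-th root gives a bound on [|f n x|] itself, uniform in [n], which passes to the
   supremum. *)
have bound n : (`|f n x|%:E <= (\sum_(0 <= m <oo) h m x) `^ p^-1)%E.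
  have -> : (`|f n x|%:E = (`|f n x|%:E `^ p) `^ p^-1)%E.
    by rewrite -poweRrM divff // poweRe1 // lee_fin.
  apply: gt0_ler_poweR; rewrite ?invr_ge0 ?(ltW p0) ?in_itv /= ?leey ?andbT ?poweR_ge0 //.
  rewrite (le_trans _ (nneseries_lim_ge n _)) //.
  by rewrite big_mkord sumEFin lee_fin; exact: normr_walsh_poly_block_powR.
have max0 : (0 <= mart_maximal f x)%E.
  by apply: (@le_trans _ _ `|f 0%N x|%:E) => //; apply: ereal_sup_ubound; exists 0%N.
rewrite -[leRHS](poweRe1 G0) -(mulVf p_neq0) poweRrM.
apply: gt0_ler_poweR; rewrite ?(ltW p0) ?in_itv /= ?leey ?andbT ?abse_ge0 ?poweR_ge0 //.
rewrite gee0_abs //; apply: ub_ereal_sup => _ [n _ <-].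
exact: bound.
Qed.

End HpNorm.

(** * Lower bounds for the Riesz means *)

Section RieszMeans.
Context (R : realType) (mu : probability G2 R).
Implicit Types (c d : nat -> R) (i j k m n N : nat) (x : G2).

(** Induction with the increment [1/n <= 2/(n+1) <= 2 (ln (n+1) - ln n)]; dividing the last term by
    [ln 2 <= 1] only enlarges it. *)
Lemma riesz_weight_le n : (2 <= n)%N ->
  riesz_weight R n <= 2 / ln 2 * ln (n%:R : R).
Proof.
have ln2_gt0 : 0 < ln (2 : R) by rewrite ln_gt0 // ltr1n.
have ln2_le1 : ln (2 : R) <= 1 by have := @le_ln1Dx R 1; apply; lra.
elim: n => // n IHn; rewrite ltnS leq_eqVlt => /predU1P[<-|n2].
  by rewrite /riesz_weight big_nat1 invr1 divfK ?gt_eqF // ler1n.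
rewrite /riesz_weight big_nat_recr ?(ltnW n2) //= -/(riesz_weight R n).
apply: (le_trans (lerD (IHn n2) (lexx _))).
have n0 : 0 < n%:R :> R by rewrite ltr0n ltnW.
have n10 : 0 < n.+1%:R :> R by rewrite ltr0n.
rewrite -lerBrDl -mulrBr.
(* This is [ln (1 + x) <= x] at [x = -1/(n+1)]. *)
have step : n.+1%:R^-1 <= ln (n.+1%:R : R) - ln n%:R.
  have := @le_ln1Dx R (- n.+1%:R^-1).
  have -> : 1 + - n.+1%:R^-1 = n%:R / n.+1%:R :> R.
    by rewrite -natr1; field; rewrite natr1 gt_eqF.
  rewrite ln_div ?posrE // lerNr opprB; apply.
  by rewrite ltrN2 invf_lt1 // ltr1n ltnS ltnW.
apply: (@le_trans _ _ (2 * n.+1%:R^-1)).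
  rewrite -[leLHS]mul1r ler_pdivrMr // mulrAC ler_pdivlMr // mul1r -natr1.
  by have : 1 <= n%:R :> R by [rewrite ler1n ltnW]; lra.
rewrite -mulrA ler_pM2l // (le_trans step) // mulrC ler_peMr ?invf_ge1 //.
by rewrite (le_trans _ step) // invr_ge0 ltW.
Qed.

Lemma riesz_weight_gt0 n : (2 <= n)%N -> 0 < riesz_weight R n.
Proof.
move=> n2; rewrite /riesz_weight big_ltn // invr1 ltr_pwDl //.
by rewrite sumr_ge0 // => k _; rewrite invr_ge0.
Qed.

(* On the half of the group where the first bit is set, the terms of index 2t
   and 2t + 1 of the partial sum cancel. *)
Lemma walsh_poly_block_odd c j x : c 0%N = 0 -> x 0%N ->
  walsh_poly (block_coef c) j.*2.+1 x = block_coef c j.*2 * walsh R j.*2 x.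
Proof.
move=> c0 x0; elim: j => [|j IHj].
  by rewrite walsh_polyS /walsh_poly big_ord0 add0r.
rewrite doubleS walsh_polyS walsh_polyS IHj walsh_doubleS x0.
have -> : block_coef c j.*2.+1 = block_coef c j.*2.
  (* Indices [2j] and [2j+1] share a block except for [j = 0], where both coefficients vanish
     because [c 0 = 0]. *)
  case: j {IHj} => [|j]; first by rewrite /= trunc_log1.
  rewrite /block_coef doubleS [in LHS]trunc_log2S // [in RHS]trunc_log2S //.
  by rewrite /= uphalf_double doubleK.
by rewrite /= expr1 mulN1r mulrN addrN add0r.
Qed.

(** This is [l_n R_n f], kept without normalisation so that consecutive terms differ by one
    summand. *)
Definition log_psum d n x : R := \sum_(1 <= k < n) walsh_poly d k x / k%:R.

Lemma measurable_log_psum d n : measurable_fun [set: G2] (log_psum d n).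
Proof.
apply: measurable_sum => k; apply: measurable_funM => //.
exact: measurable_walsh_poly.
Qed.

Lemma log_psumS d n x : (0 < n)%N ->
  log_psum d n.+1 x = log_psum d n x + walsh_poly d n x / n%:R.
Proof. by move=> n0; rewrite /log_psum big_nat_recr. Qed.

Hypothesis mu_haar : translation_invariant mu.

Lemma log_psum_pair_ge (p : R) c m j : 0 < p <= 1 ->
  (forall i, 0 <= c i) -> c 0%N = 0 -> (2 ^ m <= j.*2 < 2 ^ m.+1)%N ->
  (((c m / 2 ^+ m.+1) `^ p / 2)%:E <=
   \int[mu]_x `|(log_psum (block_coef c) j.*2.+1 x)%:E| `^ p +
   \int[mu]_x `|(log_psum (block_coef c) j.*2.+2 x)%:E| `^ p)%E.
Proof.
move=> p01 c_ge0 c0 mj; have p0 : 0 < p by case/andP: p01.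
set A := log_psum (block_coef c).
have mA n : measurable_fun [set: G2] (fun x => `|(A n x)%:E| `^ p)%E.
  apply: (measurableT_comp (measurable_poweR p)).
  apply: measurableT_comp => //; apply/measurable_EFinP.
  exact: measurable_log_psum.
have A_ge0 n x : (0 <= `|(A n x)%:E| `^ p)%E by exact: poweR_ge0.
rewrite -ge0_integralD //.
(* Only the half [x 0 = 1], of measure 1/2, is kept; there the partial sum of odd order reduces to
   one term of modulus [c m]. *)
pose E := dyadic_interval 1 (fun=> true).
have mE : measurable E := measurable_dyadic_interval 1 _.
have t0 : 0 <= (c m / 2 ^+ m.+1) `^ p by exact: powR_ge0.
apply: (@le_trans _ _ (\int[mu]_x (((c m / 2 ^+ m.+1) `^ p) * \1_E x)%:E)%E).
  under eq_integral do rewrite EFinM.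
  rewrite ge0_integralZl //; last by apply/measurable_EFinP; exact: measurable_indic.
  rewrite integral_indic // setIT [X in (_ * X)%E](haar_dyadic_interval mu_haar).
  by rewrite -EFinM expr1.
apply: ge0_le_integral => //.
- by move=> x _; rewrite lee_fin mulr_ge0.
- by apply/measurable_EFinP; apply: measurable_funM => //; exact: measurable_indic.
- exact: emeasurable_funD.
move=> x _; rewrite indicE; have [|_] := boolP (x \in E); last first.
  by rewrite mulr0 adde_ge0.
rewrite inE => /(_ 0%N isT) x0; rewrite mulr1 /= lee_fin.
have -> : c m / 2 ^+ m.+1 = `|c m| / 2 ^+ m.+1 by rewrite ger0_norm.
apply: (@le_trans _ _ ((`|A j.*2.+1 x| + `|A j.*2.+2 x|) `^ p)); last first.
  exact: powR_subadditive.
apply: ge0_ler_powR; rewrite ?nnegrE ?(ltW p0) ?addr_ge0 //.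
rewrite (@le_trans _ _ `|A j.*2.+2 x - A j.*2.+1 x|) //; last first.
  by rewrite [leRHS]addrC; exact: ler_normB.
rewrite [A j.*2.+2 x]log_psumS // addrAC subrr add0r walsh_poly_block_odd //.
(* The divisor [2j+1] is at most [2 ^ m.+1]. *)
rewrite (block_coef_exp _ mj) normrM normrM normr_walsh mulr1 normfV.
rewrite ler_wpM2l // ger0_norm // lef_pV2 ?posrE ?exprn_gt0 //.
by rewrite -natrX ler_nat; case/andP: mj.
Qed.

Lemma riesz_mean_walsh_poly d n x :
  riesz_mean mu (fun n => walsh_poly d (2 ^ n)) n x =
  (riesz_weight R n)^-1 * log_psum d n x.
Proof.
congr (_ * _); apply: eq_bigr => k _.
by rewrite mart_walsh_psum_poly.
Qed.

(** The logarithm in the series absorbs the normalisation of the mean: [ln n / l_n] is at least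
    [ln 2 / 2]. *)
Lemma Lnorm_riesz_mean_ge (p : R) d n : 0 < p -> (2 <= n)%N ->
  (((ln 2 / 2) `^ p)%:E * \int[mu]_x `|(log_psum d n x)%:E| `^ p <=
   (ln (n%:R : R) `^ p)%:E *
   'N[mu]_(p%:E)[EFin \o riesz_mean mu (fun n => walsh_poly d (2 ^ n)) n] `^ p)%E.
Proof.
move=> p0 n2; rewrite poweR_Lnorm ?gt_eqF //.
have l0 := riesz_weight_gt0 n2.
have ln2_gt0 : 0 < ln (2 : R) by rewrite ln_gt0 // ltr1n.
under [in leRHS]eq_integral => x _.
  rewrite /= riesz_mean_walsh_poly normrM (gtr0_norm (x := _^-1)) ?invr_gt0 //.
  rewrite powRM ?invr_ge0 ?(ltW l0) // EFinM.
  over.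
rewrite ge0_integralZl //; last 2 first.
- apply/measurable_EFinP; apply: (measurableT_comp (measurable_powR p)).
  by apply: measurableT_comp => //; exact: measurable_log_psum.
- by rewrite lee_fin powR_ge0.
rewrite muleA; apply: lee_wpmul2r.
  by apply: integral_ge0 => x _; exact: poweR_ge0.
have lnn : 0 <= ln (n%:R : R) by rewrite ln_ge0 // ler1n ltnW.
rewrite -EFinM lee_fin -powRM ?invr_ge0 ?(ltW l0) //.
apply: ge0_ler_powR; rewrite ?nnegrE ?(ltW p0) ?divr_ge0 ?(ltW l0) ?(ltW ln2_gt0) //.
rewrite ler_pdivlMr // mulrC -ler_pdivlMr ?divr_gt0 //.
by rewrite invf_div mulrC riesz_weight_le.
Qed.

End RieszMeans.

(** * Summation by pairs and arithmetic of exponents *)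

Lemma pair_sum_ge (R : realType) (u : nat -> \bar R) (a q : nat) (t : R) :
  (forall j, (j < q)%N -> (t%:E <= u (a + j.*2)%N + u (a + j.*2).+1)%E) ->
  ((q%:R * t)%:E <= \sum_(a <= n < a + q.*2) u n)%E.
Proof.
elim: q => [|q IHq] ut; first by rewrite mul0r addn0 big_geq.
have aq : (a <= a + q.*2)%N by rewrite leq_addr.
rewrite doubleS !addnS big_nat_recr ?(leqW aq) //= big_nat_recr //= -addeA.
rewrite -natr1 mulrDl mul1r EFinD leeD //; last exact: ut.
by apply: IHq => j jq; apply: ut; exact: ltnW.
Qed.

(** With [B = 2 ^ m], this justifies the choice of [c m]: it makes the weight of block [m] in the
    Hardy norm bound equal to [a]. *)
Lemma block_weight_powR (R : realType) (p a B : R) : 0 < p -> 0 <= a -> 0 < B ->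
  ((a * B `^ (1 - p)) `^ p^-1 * B) `^ p / B = a.
Proof.
move=> p0 a0 B0; have p_neq0 : p != 0 by rewrite gt_eqF.
rewrite powRM ?powR_ge0 ?(ltW B0) // -powRrM mulVf // powRr1; last first.
  by rewrite mulr_ge0 // powR_ge0.
have B_neq0 : B != 0 by rewrite gt_eqF.
rewrite -(mulrA a) -powRD ?B_neq0 ?implybT // subrK powRr1 ?(ltW B0) //.
by rewrite mulfK.
Qed.

(** The left side bounds the contribution of one pair of block [m], with [B = 2 ^ m]. The exponents
    of [B] add up to [-(2-2p) - p + (1-p) = -1], which the number of pairs, [B / 2], compensates. *)
Lemma block_bound_powR (R : realType) (p a B F K : R) :
  0 < p -> 0 <= a -> 0 < B ->
  K * F / (2 * B) `^ (2 - 2 * p) *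
    (((a * B `^ (1 - p)) `^ p^-1 / (2 * B)) `^ p / 2) =
  K * 2 `^ (p - 3) * (a * F) / B.
Proof.
move=> p0 a0 B0; have p_neq0 : p != 0 by rewrite gt_eqF.
have B_neq0 : B != 0 by rewrite gt_eqF.
have B20 : 0 <= 2 * B by rewrite mulr_ge0 // ltW.
rewrite (@powRM _ _ (2 * B)^-1 p) ?powR_ge0 ?invr_ge0 // -powRrM mulVf // powRr1; last first.
  by rewrite mulr_ge0 // powR_ge0.
have -> : (2 * B)^-1 `^ p = (2 * B) `^ (-1 * p) by rewrite powRrM powR_inv1.
rewrite -(powRN (2 * B)) !(powRM _ _ (ltW B0)) //.
have e2 : 2 `^ (p - 3) = 2 `^ (- (2 - 2 * p)) * 2 `^ (-1 * p) / 2 :> R.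
  rewrite -[X in _ / X]powRr1 // -powRN -!powRD ?pnatr_eq0 ?implybT //.
  by congr (_ `^ _); ring.
have eB : B^-1 = B `^ (- (2 - 2 * p)) * B `^ (-1 * p) * B `^ (1 - p).
  rewrite -powR_inv1 ?(ltW B0) // -!powRD ?B_neq0 ?implybT //.
  by congr (_ `^ _); ring.
by rewrite e2 eB; ring.
Qed.

(** * Choice of the coefficients and divergence of the series *)

Theorem mainTheorem16 (R : realType) (mu : probability G2 R)
  (mu_haar : translation_invariant mu)
  (p : R) (p_gt0 : 0 < p) (p_lt : p < 1 / 2)
  (Phi : nat -> R) (Phi_ge1 : forall n : nat, 1 <= Phi n)
  (Phi_nd : forall m n : nat, (m <= n)%N -> Phi m <= Phi n)
  (Phi_oo : Phi n @[n --> \oo] --> +oo) :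
  exists f : nat -> G2 -> R,
    [/\ martingale mu f,
        (Hp_norm mu p f < +oo)%E &
        (\sum_(2 <= n <oo)
           ((ln (n%:R : R) `^ p)%:E
            * 'N[mu]_(p%:E)[EFin \o riesz_mean mu f n] `^ p
            * (Phi n)%:E
            * ((n%:R `^ (2 - 2 * p))^-1)%:E) = +oo)%E].
Proof.
have p01 : 0 < p <= 1 by rewrite p_gt0; lra.
pose F m := Phi (2 ^ m)%N.
have F_gt0 m : 0 < F m by exact: lt_le_trans (Phi_ge1 _).
have F_nd m n : (m <= n)%N -> F m <= F n.
  by move=> mn; apply: Phi_nd; rewrite leq_pexp2l.
(* As [0.-1] is 0, [a 0] vanishes, which yields [c 0 = 0]. *)
pose a m : R := (F m.-1)^-1 - (F m)^-1.
have a_ge0 m : 0 <= a m by rewrite subr_ge0 lef_pV2 ?posrE // F_nd // leq_pred.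
pose c m : R := (a m * (2 ^+ m) `^ (1 - p)) `^ p^-1.
have c_ge0 m : 0 <= c m by exact: powR_ge0.
have c0 : c 0%N = 0 by rewrite /c /a subrr mul0r powR0 // invr_neq0 // gt_eqF.
have exp2_gt0 m : 0 < 2 ^+ m :> R by exact: exprn_gt0.
exists (fun n => walsh_poly (block_coef c) (2 ^ n)); split.
- exact: walsh_poly_martingale.
- apply: (@lty_poweRy _ _ p); first by rewrite gt_eqF.
  apply: le_lt_trans (Hp_norm_walsh_poly_block mu_haar p01 c_ge0) _.
  apply: (@le_lt_trans _ _ ((F 0%N)^-1)%:E); last exact: ltry.
  apply: lime_le.
    by apply: is_cvg_nneseries => n _ _; rewrite lee_fin divr_ge0 ?powR_ge0 // ltW.
  apply: nearW => n; rewrite big_mkord sumEFin lee_fin.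
  under eq_bigr do rewrite block_weight_powR //.
  (* The partial sums of [a] telescope to this value. *)
  apply: (@le_trans _ _ ((F 0%N)^-1 - (F n.-1)^-1)); last first.
    by rewrite gerBl // invr_ge0 ltW.
  elim: n => [|n IHn]; first by rewrite big_ord0 subrr.
  rewrite big_ord_recr /= (le_trans (lerD IHn (lexx _))) // /a.
  by rewrite addrA subrK.
pose T n := ((ln (n%:R : R) `^ p)%:E
  * 'N[mu]_(p%:E)[EFin \o riesz_mean mu
      (fun n => walsh_poly (block_coef c) (2 ^ n)) n] `^ p
  * (Phi n)%:E * ((n%:R `^ (2 - 2 * p))^-1)%:E)%E.
rewrite -/T.
have T_ge0 n : (0 <= T n)%E.
  rewrite !mule_ge0 ?poweR_ge0 ?lee_fin ?powR_ge0 ?invr_ge0 ?powR_ge0 //.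
  exact: le_trans (Phi_ge1 n).
pose V n := (\int[mu]_x `|(log_psum (block_coef c) n x)%:E| `^ p)%E.
have V_ge0 n : (0 <= V n)%E by apply: integral_ge0 => x _; exact: poweR_ge0.
pose K : R := (ln 2 / 2) `^ p.
(* Here [Phi n >= F m] and [n <= 2 ^ m.+1]. The right endpoint is included because the last pair of
   a block ends there. *)
have TV m n : (2 ^ m <= n <= 2 ^ m.+1)%N -> (2 <= n)%N ->
    ((K * F m / (2 * 2 ^+ m) `^ (2 - 2 * p))%:E * V n <= T n)%E.
  move=> /andP[mn nm] n2.
  have e_ge0 : 0 <= 2 - 2 * p by lra.
  have n0 : 0 < n%:R :> R by rewrite ltr0n ltnW.
  have -> : ((K * F m / (2 * 2 ^+ m) `^ (2 - 2 * p))%:E * V n =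
      K%:E * V n * (F m / (2 * 2 ^+ m) `^ (2 - 2 * p))%:E)%E.
    by rewrite -mulrA EFinM -!muleA; congr (_ * _)%E; rewrite muleC.
  rewrite /T -[leRHS]muleA -EFinM; apply: lee_pmul.
  - by rewrite mule_ge0 // lee_fin powR_ge0.
  - by rewrite lee_fin divr_ge0 ?powR_ge0 // ltW.
  - exact: Lnorm_riesz_mean_ge.
  rewrite lee_fin ler_pM ?invr_ge0 ?powR_ge0 ?(ltW (F_gt0 _)) //.
    exact: Phi_nd.
  rewrite lef_pV2 ?posrE ?powR_gt0 ?mulr_gt0 //.
  apply: ge0_ler_powR; rewrite ?nnegrE ?mulr_ge0 ?(ltW (exp2_gt0 _)) //.
  by rewrite -exprS -natrX ler_nat.
pose D : R := K * 2 `^ (p - 3) / 2.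
have D_gt0 : 0 < D.
  by rewrite !mulr_gt0 ?invr_gt0 ?powR_gt0 // divr_gt0 // ln_gt0 // ltr1n.
(* Block [m.+1] provides [2 ^ m] pairs [(2j+1, 2j+2)], filling the indices from [2^(m+1) + 1] to
   [2^(m+2)]. *)
have block_ge m : ((D * (a m.+1 * F m.+1))%:E <=
    \sum_((2 ^ m.+1).+1 <= n < (2 ^ m.+2).+1) T n)%E.
  have -> : (2 ^ m.+2).+1 = ((2 ^ m.+1).+1 + (2 ^ m).*2)%N.
    by rewrite !expnS; lia.
  have -> : D * (a m.+1 * F m.+1) =
      (2 ^ m)%:R * (K * 2 `^ (p - 3) * (a m.+1 * F m.+1) / 2 ^+ m.+1).
    by rewrite natrX exprS /D; field; rewrite gt_eqF.
  apply: pair_sum_ge => j jm.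
  have mj : (2 ^ m.+1 <= (2 ^ m + j).*2 < 2 ^ m.+2)%N by rewrite !expnS; lia.
  have -> : ((2 ^ m.+1).+1 + j.*2 = (2 ^ m + j).*2.+1)%N by rewrite expnS; lia.
  have pow_gt0 : (0 < 2 ^ m)%N by rewrite expn_gt0.
  rewrite -block_bound_powR //.
  apply: (le_trans _ (leeD (TV m.+1 _ _ _) (TV m.+1 _ _ _))); try by rewrite ?expnS; lia.
  rewrite -ge0_muleDr // EFinM lee_wpmul2l //.
    by rewrite lee_fin divr_ge0 ?powR_ge0 // mulr_ge0 ?powR_ge0 // ltW.
  rewrite -exprS; exact: log_psum_pair_ge.
(* The right side is [F k.+1 / F k - 1], and [ln y <= y - 1]. *)
have a_ln k : ln (F k.+1) - ln (F k) <= a k.+1 * F k.+1.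
  rewrite -ln_div ?posrE // /a /= mulrBl mulVf ?gt_eqF // (mulrC _^-1).
  have := @le_ln1Dx R (F k.+1 / F k - 1); rewrite addrCA subrr addr0; apply.
  by rewrite ltrBrDl subrr divr_gt0.
(* The logarithms telescope over the blocks; the sum starts at [3 = 2^1 + 1], so it is empty for
   [m = 0]. *)
have partial_ge m : ((D * (ln (F m) - ln (F 0%N)))%:E <=
    \sum_(3 <= n < (2 ^ m.+1).+1) T n)%E.
  elim: m => [|m IHm]; first by rewrite subrr mulr0 big_geq.
  rewrite (big_cat_nat (n := (2 ^ m.+1).+1)) //=; last 2 first.
  - by rewrite expnS ltnS; have : (0 < 2 ^ m)%N by [rewrite expn_gt0]; lia.
  - by rewrite ltnS leq_pexp2l.
  apply: (le_trans _ (leeD IHm (block_ge m))).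
  rewrite -EFinD -mulrDr lee_fin ler_pM2l //.
  by have := a_ln m; lra.
apply/eqyP => t t0.
(* Chosen so that [ln (F N) >= M] makes the lower bound of [partial_ge] at least [t]. *)
pose M := t / D + ln (F 0%N).
have [N _ hN] := (cvgryPge _).1 Phi_oo (expR M).
have FN : expR M <= F N.
  by apply: hN => /=; rewrite ltnW // ltn_expl.
apply: (le_trans _ (nneseries_lim_ge (2 ^ N.+1).+1 _)); last first.
  by move=> n _ _; exact: T_ge0.
rewrite big_ltn; last first.
  by rewrite ltnS expnS; have : (0 < 2 ^ N)%N by [rewrite expn_gt0]; lia.
apply: (le_trans (le_trans _ (partial_ge N))); last by rewrite leeDr //; exact: T_ge0.
rewrite lee_fin mulrC -ler_pdivrMr // lerBrDr -/M -[M]expRK ler_ln ?posrE //.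
exact: expR_gt0.
Qed.
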